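(* Let $\mathscr C$ be a countable collection of measurable sets in $(\mathcal X,\mathcal A)$, and suppose that for some $\alpha>0$, $\alpha\neq1$, and some constant $L>0$, $\log\mathcal N_I(\epsilon,\mathscr C,P)\le L\epsilon^{-\alpha}$ for all $\epsilon>0$. For $C_0\in\mathscr C$ let $Y_i=\mathbf 1_{C_0}(X_i)+\xi_i$, $i=1,\dots,n$, where $X_1,\dots,X_n$ are i.i.d. with law $P$ and $\xi_1,\dots,\xi_n$ are i.i.d. $\mathcal N(0,1)$ independent of the $X_i$'s, and let $\widehat C_n\in\arg\min_{C\in\mathscr C}\sum_{i=1}^n(Y_i-\mathbf 1_C(X_i))^2$. Then $$\sup_{C_0\in\mathscr C}\mathbb E_{C_0}P|\widehat C_n\Delta C_0|\lesssim n^{-1/(\alpha+1)},$$ where the implied constant does not depend on $n$ (it depends only on $\alpha$ and $L$).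
   Context: $\mathcal N_I(\epsilon,\mathscr C,P)$ is the $\epsilon$-bracketing number of $\{\mathbf 1_C:C\in\mathscr C\}$ in $L_1(P)$: the minimum number of brackets $[\ell,u]=\{f:\ell\le f\le u\}$ with $\|u-\ell\|_{L_1(P)}<\epsilon$ needed to cover the class; $\log$ is the ordinary natural logarithm here. $P|\widehat C_n\Delta C_0|=\int(\mathbf 1_{\widehat C_n}-\mathbf 1_{C_0})^2\,dP$. $\mathbb E_{C_0}$ is expectation under the model with true set $C_0$. The least squares estimator $\widehat C_n$ is assumed to be well-defined. *)

(* Defs.v *)
From HB Require Import structures.
From mathcomp Require Import all_boot all_order all_algebra.
From mathcomp Require Import all_classical all_reals all_analysis.

Set Implicit Arguments.
Unset Strict Implicit.
Unset Printing Implicit Defensive.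

Import Order.TTheory GRing.Theory Num.Theory.
Import numFieldNormedType.Exports.

Local Open Scope classical_set_scope.
Local Open Scope ring_scope.

Section bracketing.
Context {d : measure_display} {T : measurableType d} {R : realType}.
Variable P : probability T R.

Definition bracket (l u : T -> R) : set (T -> R) :=
  [set f | forall x, l x <= f x <= u x].

Definition bracket_cover (eps : R) (F : set (T -> R)) (N : nat) : Prop :=
  exists l u : 'I_N -> T -> R,
    [/\ forall i, l i \in Lfun P 1 /\ u i \in Lfun P 1,
        forall i, ('N[P]_1[EFin \o (u i \- l i)%R] < eps%:E)%E
      & F `<=` \bigcup_(i in [set: 'I_N]) bracket (l i) (u i)].

(* The infimum of a set of natural numbers: it is attained when the set is
   nonempty, and it is +oo when no finite bracket cover exists. *)
Definition bracketing_number (eps : R) (F : set (T -> R)) : \bar R :=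
  ereal_inf [set N%:R%:E | N in bracket_cover eps F].

Definition bracketing_number_sets (eps : R) (CC : set (set T)) : \bar R :=
  bracketing_number eps [set (\1_C : T -> R) | C in CC].

(* P|C Delta D| *)
Definition symdiff_loss (C D : set T) : R :=
  (\int[P]_x ((\1_C x - \1_D x) ^+ 2))%R.

End bracketing.

Section independence.
Context {d : measure_display} {Omega : measurableType d} {R : realType}.
Variable Q : probability Omega R.

Definition mutually_independent {d' : measure_display} {T : measurableType d'}
    (I : finType) (X : I -> {RV Q >-> T}) : Prop :=
  forall (J : {set I}) (A : I -> set T), (forall i, measurable (A i)) ->
    Q (\bigcap_(i in [set i | i \in J]) (X i @^-1` A i)) =
    (\prod_(i in J) Q (X i @^-1` A i))%E.

(* Equality of laws is only required on measurable sets, since the set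
   functions underlying measures are unconstrained elsewhere. *)
Definition iid {d' : measure_display} {T : measurableType d'}
    (I : finType) (X : I -> {RV Q >-> T}) (mu : set T -> \bar R) : Prop :=
  mutually_independent X /\
  forall i (A : set T), measurable A -> distribution Q (X i) A = mu A.

Definition independent_vectors {d1 d2 : measure_display}
    {T1 : measurableType d1} {T2 : measurableType d2} (n : nat)
    (X : 'I_n -> {RV Q >-> T1}) (Y : 'I_n -> {RV Q >-> T2}) : Prop :=
  let vX (w : Omega) := [tuple X i w | i < n] in
  let vY (w : Omega) := [tuple Y i w | i < n] in
  forall (A : set (n.-tuple T1)) (B : set (n.-tuple T2)),
    measurable A -> measurable B ->
    Q (vX @^-1` A `&` vY @^-1` B) = (Q (vX @^-1` A) * Q (vY @^-1` B))%E.

End independence.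

Section regression.
Context {d : measure_display} {T : measurableType d} {R : realType}.

Definition regression_sample {d' : measure_display} {Omega : measurableType d'}
    {Q : probability Omega R} (n : nat) (X : 'I_n -> {RV Q >-> T})
    (xi : 'I_n -> {RV Q >-> R}) (C0 : set T) (w : Omega) : n.-tuple (T * R) :=
  [tuple (X i w, \1_C0 (X i w) + xi i w) | i < n].

Definition residual_sum_squares (n : nat) (z : n.-tuple (T * R)) (C : set T) : R :=
  \sum_(i < n) ((tnth z i).2 - \1_C (tnth z i).1) ^+ 2.

(* The last conjunct is the measurability that gives a meaning to the
   expected loss under each true set. *)
Definition least_squares_estimator (P : probability T R) (CC : set (set T))
    (n : nat) (Chat : n.-tuple (T * R) -> set T) : Prop :=
  [/\ forall z, CC (Chat z),
      forall z C, CC C ->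
        residual_sum_squares z (Chat z) <= residual_sum_squares z C
    & forall C0, CC C0 ->
        measurable_fun [set: n.-tuple (T * R)]
          (fun z => symdiff_loss P (Chat z) C0)].

End regression.

(* Main.v *)
Require Import Defs.
From HB Require Import structures.
From mathcomp Require Import all_boot all_order all_algebra.
From mathcomp Require Import all_classical all_reals all_analysis measurable_realfun.
From mathcomp Require Import ring lra.

Set Implicit Arguments.
Unset Strict Implicit.
Unset Printing Implicit Defensive.

Import Order.TTheory GRing.Theory Num.Theory.
Import numFieldNormedType.Exports.

Local Open Scope classical_set_scope.
Local Open Scope ring_scope.

(* A single scale suffices; no chaining is needed.  Let r = n^(-1/(alpha+1)), so
   that n r = r^(-alpha) >= 1 dominates the bracketing entropy at scale r.
   Brackets of indicators reduce to pairs of sets A <= B with P(B \ A) <= r.  If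
   A <= C <= B, then exp((RSS(C0) - RSS(C))/4) is at most a product over the
   sample of weights that depend on (A, B, C0) but not on C.  By the Gaussian
   moment generating function each weight has expectation at most
   exp(-kappa P(A Delta C0) + M r).  For the least squares estimator the product
   is at least 1, so exp(kappa n P|Chat Delta C0|) is bounded by a sum over the
   exp(O(n r)) brackets of terms with expectation exp(O(n r)), and
   t <= s + exp(t - s) turns this into a bound on the expected loss. *)

(** * Integrals under image laws and independence *)

(** The last equation on indicators says that [nu] is the image under [Y] of the measure with
    density [g] with respect to [mu], on measurable sets only. Simple functions and monotone
    convergence extend it to nonnegative [f]. The density serves three purposes below: the remaining
    factors of an independent product, the Gaussian density, and the constant 1. *)
Lemma ge0_integral_transfer d d' (S : measurableType d) (T : measurableType d')
    (R : realType) (mu : {measure set S -> \bar R})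
    (nu : {measure set T -> \bar R}) (Y : S -> T) (g : S -> R) (f : T -> R) :
  measurable_fun setT Y -> measurable_fun setT g -> (forall w, 0 <= g w) ->
  (forall A, measurable A ->
    (\int[mu]_w (g w * \1_A (Y w))%:E = nu A)%E) ->
  measurable_fun setT f -> (forall x, 0 <= f x) ->
  (\int[mu]_w (g w * f (Y w))%:E = \int[nu]_x (f x)%:E)%E.
Proof.
Import HBNNSimple.
move=> mY mg g0 gnu mf f0.
have mEf : measurable_fun setT (EFin \o f) by exact/measurable_EFinP.
pose h := nnsfun_approx measurableT mEf.
have mI A : measurable A -> measurable_fun setT (fun w => g w * \1_A (Y w)).
  move=> mA; apply: measurable_funM => //.
  exact: (measurableT_comp (measurable_indic mA) mY).
have hf x : (f x)%:E = lim ((h n x)%:E @[n --> \oo]).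
  by apply/esym/cvg_lim => //; apply: cvg_nnsfun_approx => // t _ /=; rewrite lee_fin.
have mh n : measurable_fun setT (h n \o Y).
  by apply: measurableT_comp => //; exact/measurable_funP.
have -> : (\int[nu]_x (f x)%:E =
    lim (\int[nu]_x (h n x)%:E @[n --> \oo]))%E.
  under eq_integral do rewrite hf.
  apply: monotone_convergence => //.
  - by move=> n; apply/measurable_EFinP; exact/measurable_funP.
  - by move=> n x _; rewrite lee_fin.
  - by move=> x _ a b ab; rewrite lee_fin; apply/lefP/nd_nnsfun_approx.
have -> : (\int[mu]_w (g w * f (Y w))%:E =
    lim (\int[mu]_w (g w * h n (Y w))%:E @[n --> \oo]))%E.
  have gh w : (g w * f (Y w))%:E = lim ((g w * h n (Y w))%:E @[n --> \oo]).
    apply/esym/cvg_lim => //; rewrite EFinM.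
    under eq_fun do rewrite EFinM.
    apply: cvgeZl => //.
    by apply: cvg_nnsfun_approx => // t _ /=; rewrite lee_fin.
  under eq_integral do rewrite gh.
  apply: monotone_convergence => //.
  - by move=> n; apply/measurable_EFinP; exact: measurable_funM mg (mh n).
  - by move=> n x _; rewrite lee_fin mulr_ge0.
  - move=> x _ a b ab; rewrite lee_fin ler_wpM2l//.
    exact/lefP/nd_nnsfun_approx.
(* Both sides are now limits along the same simple functions, so it suffices to compare them for
   each [h n], value by value. *)
congr (limn _); apply/funext => n.
transitivity (\int[mu]_w (\sum_(y \in range (h n))
    (y%:E * (g w * \1_(h n @^-1` [set y]) (Y w))%:E)))%E.
  apply: eq_integral => w _.
  rewrite [in LHS]fimfunE EFinM -fsumEFin// ge0_mule_fsumr; last first.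
    by move=> y; exact: nnfun_muleindic_ge0.
  by apply: eq_fsbigr => y _; rewrite -!EFinM mulrCA.
rewrite ge0_integral_fsum//; last 2 first.
- by move=> y; apply: measurable_funeM; exact/measurable_EFinP/mI.
(* Nonnegativity is required for every real [y], even a negative one; outside the range of [h n] the
   preimage is empty and the term vanishes. *)
- move=> y w _; have [ny|ny] := boolP (y \in range (h n)).
    by move: ny; rewrite inE => -[t _ <-]; rewrite -EFinM lee_fin !mulr_ge0.
  rewrite (_ : h n @^-1` [set y] = set0) ?indic0 ?mulr0 ?mule0//.
  by apply/preimage10; move: ny; rewrite notin_setE.
transitivity (\int[nu]_x (\sum_(y \in range (h n))
    (y%:E * (\1_(h n @^-1` [set y]) x)%:E)))%E; last first.
  apply: eq_integral => x _; rewrite [in RHS]fimfunE -fsumEFin//.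
rewrite ge0_integral_fsum//; last 2 first.
- move=> y; apply: measurable_funeM; exact/measurable_EFinP/measurable_indic.
- move=> y x _; rewrite -EFinM; exact: nnfun_muleindic_ge0.
apply: eq_fsbigr => y; rewrite inE => -[t _ <-].
rewrite !ge0_integralZl//=.
- by rewrite gnu// integral_indic// setIT.
all: rewrite ?lee_fin//.
- exact/measurable_EFinP/measurable_indic.
- exact/measurable_EFinP/mI.
- by move=> w _; rewrite lee_fin mulr_ge0.
Qed.

(** Independence of events is upgraded to independence of nonnegative functions. The extra event [H]
    leaves room for a condition on the design points, with the [Y i] in the role of the noise. *)
Lemma ge0_integral_prod_indep d d' (S : measurableType d) (T : measurableType d')
    (R : realType) (Q : probability S R) (I : finType) (Y : I -> {RV Q >-> T})
    (H : set S) (f : I -> T -> R) (m : I -> R) :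
  measurable H ->
  (forall A : I -> set T, (forall i, measurable (A i)) ->
    Q (H `&` \bigcap_i (Y i @^-1` A i)) = (Q H * \prod_i Q (Y i @^-1` A i))%E) ->
  (forall i, measurable_fun setT (f i)) -> (forall i x, 0 <= f i x) ->
  (forall i, (\int[Q]_w (f i (Y i w))%:E = (m i)%:E)%E) ->
  (\int[Q]_w (\1_H w * \prod_i f i (Y i w))%:E =
    (fine (Q H) * \prod_i m i)%:E)%E.
Proof.
move=> mH indep mf f0 fm.
have mY i : measurable_fun setT (Y i) by [].
pose nu i := distribution Q (Y i).
have m0 i : 0 <= m i.
  by rewrite -lee_fin -fm integral_ge0// => x _; rewrite lee_fin.
pose F (s : seq I) (A : I -> set T) i x := if i \in s then f i x else \1_(A i) x.
pose M (s : seq I) (A : I -> set T) i := if i \in s then m i else fine (nu i (A i)).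
have F0 s A i x : 0 <= F s A i x by rewrite /F; case: ifP.
have M0 s A i : 0 <= M s A i by rewrite /M; case: ifP => // _; rewrite fine_ge0.
have mF s A i : (forall i, measurable (A i)) ->
    measurable_fun setT (fun w => F s A i (Y i w)).
  move=> mA; rewrite /F; case: (i \in s).
    exact: (measurableT_comp (mf i) (mY i)).
  exact: (measurableT_comp (measurable_indic (mA i)) (mY i)).
(* The indicators of arbitrary events are replaced by the functions [f i], one
   index at a time. *)
suff main s : uniq s -> forall A, (forall i, measurable (A i)) ->
    (\int[Q]_w (\1_H w * \prod_i F s A i (Y i w))%:E =
      (fine (Q H) * \prod_i M s A i)%:E)%E.
  have := main _ (enum_uniq I) (fun=> setT) (fun=> measurableT).
  rewrite /F /M; under eq_bigr do rewrite mem_enum/=.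
  by under eq_integral do under eq_bigr do rewrite mem_enum/=.
elim: s => [_ A mA|j s ih /= /andP[js us] A mA].
  have mYA i : measurable (Y i @^-1` A i).
    by have := mY i measurableT _ (mA i); rewrite setTI.
  have mC : measurable (\bigcap_i (Y i @^-1` A i)).
    by apply: fin_bigcap_measurable => // i _.
  rewrite (eq_integral (fun w =>
    (\1_(H `&` \bigcap_i (Y i @^-1` A i)) w)%:E)); last first.
    move=> w _; rewrite indicI /=; congr (_ * _)%:E.
    have [wA|wA] := pselect ((\bigcap_i (Y i @^-1` A i)) w).
      rewrite [RHS]indicE mem_set// big1// => i _.
      by rewrite /F/= indicE mem_set//; exact: wA.
    rewrite [RHS]indicE memNset//.
    have [i wi] : exists i, ~ A i (Y i w).
      by apply/existsNP => wA'; apply: wA => i _; exact: wA'.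
    by rewrite (bigD1 i)//= /F/= indicE memNset// mul0r.
  rewrite integral_indic ?setIT//; last exact: measurableI.
  apply: (etrans (indep A mA)); rewrite EFinM fineK ?fin_num_measure//; congr (_ * _)%E.
  rewrite -prodEFin; apply: eq_bigr => i _.
  by rewrite /M/= fineK ?fin_num_measure.
(* [g] collects everything except the factor at [j]. The induction hypothesis, with the event at [j]
   left free, says that [Y j] has image law [c] times [nu j] under the density [g]; the transfer
   lemma then puts [f j] in place of the indicator. *)
pose g w := \1_H w * \prod_(i | i != j) F s A i (Y i w).
pose c := fine (Q H) * \prod_(i | i != j) M s A i.
have c0 : 0 <= c by rewrite mulr_ge0 ?fine_ge0// prodr_ge0.
have FjE w : \1_H w * \prod_i F (j :: s) A i (Y i w) = g w * f j (Y j w).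
  rewrite (bigD1 j)//= mulrCA mulrC /F in_cons eqxx; congr (_ * _ * _).
  by apply: eq_bigr => i ij; rewrite /F in_cons (negbTE ij).
under eq_integral do rewrite FjE.
rewrite (@ge0_integral_transfer _ _ _ _ _ _ (mscale (NngNum c0) (nu j)))//.
- rewrite ge0_integral_mscale//=; last 2 first.
    exact/measurable_EFinP.
    by move=> x _; rewrite lee_fin.
  rewrite ge0_integral_distribution//; last 2 first.
    exact/measurable_EFinP.
    by move=> x; rewrite lee_fin.
  rewrite fm -EFinM (bigD1 j)//= /c {2}/M in_cons eqxx/= mulrAC -mulrA; congr (_ * (_ * _))%:E.
  by apply: eq_bigr => i ij; rewrite /M in_cons (negbTE ij).
- apply: measurable_funM => //.
  under eq_fun do rewrite -big_filter.
  by apply: measurable_prod => i _; exact: mF.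
- by move=> w; rewrite mulr_ge0// prodr_ge0.
move=> B mB; pose A' i := if i == j then B else A i.
have mA' i : measurable (A' i) by rewrite /A'; case: ifP.
have := ih us A' mA'.
have -> : (fine (Q H) * \prod_i M s A' i)%:E = mscale (NngNum c0) (nu j) B.
  rewrite /mscale/= -[X in _ = (_ * X)%E]fineK ?fin_num_measure// -EFinM; congr EFin.
  rewrite (bigD1 j)//= /c {1}/M (negbTE js) /A' eqxx mulrCA mulrC; congr (_ * _ * _).
  by apply: eq_bigr => i ij; rewrite /M (negbTE ij).
move=> E; apply: (etrans _ E); apply: eq_integral => w _; congr EFin.
rewrite (bigD1 j)//= /g {2}/F (negbTE js) /A' eqxx mulrAC -mulrA; congr (_ * (_ * _)).
by apply: eq_bigr => i ij; rewrite /F (negbTE ij).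
Qed.

(** Expanding the product of sums gives one term per assignment [t] of a cell to each observation.
    The event [H t] depends on the design alone, so each term factorizes, and the factorized terms
    recombine into an n-th power. The cells need not be disjoint, as only linearity is used. *)
Lemma ge0_integral_regression_prod d d' (S : measurableType d)
    (T : measurableType d') (R : realType) (Q : probability S R)
    (P : probability T R) (n : nat)
    (X : 'I_n -> {RV Q >-> T}) (xi : 'I_n -> {RV Q >-> R})
    (K : finType) (B : K -> set T) (F : K -> R -> R) (m : K -> R) :
  iid X P -> mutually_independent xi -> independent_vectors X xi ->
  (forall a, measurable (B a)) ->
  (forall a, measurable_fun setT (F a)) -> (forall a x, 0 <= F a x) ->
  (forall a k, (\int[Q]_w (F a (xi k w))%:E = (m a)%:E)%E) ->
  (\int[Q]_w (\prod_k \sum_a \1_(B a) (X k w) * F a (xi k w))%:E =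
    ((\sum_a fine (P (B a)) * m a) ^+ n)%:E)%E.
Proof.
move=> [Xind Xlaw] xiind ind mB mF F0 Fm.
have mXB k A : measurable A -> measurable (X k @^-1` A).
  by move=> mA; have := measurable_funP (X k) measurableT _ mA; rewrite setTI.
pose H (t : {ffun 'I_n -> K}) := \bigcap_k (X k @^-1` B (t k)).
have mH t : measurable (H t).
  by apply: fin_bigcap_measurable => // k _; exact: mXB.
have bigcapT (f : 'I_n -> set S) :
    \bigcap_(i in [set i | i \in [set: 'I_n]%SET]) f i = \bigcap_i f i.
  by congr bigcap; apply/seteqP; split => i //= _; rewrite finset.inE.
have QH t : Q (H t) = (\prod_k P (B (t k)))%E.
  rewrite /H -bigcapT Xind//; under eq_bigl do rewrite finset.inE.
  by apply: eq_bigr => k _; rewrite -(Xlaw k).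
have indH t A : (forall k, measurable (A k)) ->
    Q (H t `&` \bigcap_k (xi k @^-1` A k)) = (Q (H t) * \prod_k Q (xi k @^-1` A k))%E.
  move=> mA.
  (* Independence of design and noise is stated for tuples; intersections over the coordinates are
     rewritten as preimages of measurable boxes. *)
  have mbox d0 (V : measurableType d0) (D : 'I_n -> set V) :
      (forall k, measurable (D k)) ->
      measurable [set z : n.-tuple V | forall k, D k (tnth z k)].
    move=> mD; rewrite (_ : mkset _ = \bigcap_k ((@tnth n V)^~ k @^-1` D k)).
      apply: fin_bigcap_measurable => // k _.
      by have := measurable_tnth k measurableT (mD k); rewrite setTI.
    by apply/seteqP; split => z /= zD k; [move=> _|]; exact: zD.
  have vecE d0 (V : measurableType d0) (D : 'I_n -> set V) (Y : 'I_n -> {RV Q >-> V}) :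
      \bigcap_k (Y k @^-1` D k) =
      (fun w => [tuple Y i w | i < n]) @^-1` [set z | forall k, D k (tnth z k)].
    apply/seteqP; split => w /= wD k; first by rewrite tnth_mktuple; exact: wD.
    by move=> _; have := wD k; rewrite tnth_mktuple.
  rewrite /H !vecE ind; [|exact: (mbox _ _ (fun k => B (t k)))|exact: (mbox _ _ A)].
  rewrite -!vecE; congr (_ * _)%E; rewrite -bigcapT xiind//.
  by under eq_bigl do rewrite finset.inE.
have expand w : \prod_k \sum_a \1_(B a) (X k w) * F a (xi k w) =
    \sum_(t : {ffun 'I_n -> K}) \1_(H t) w * \prod_k F (t k) (xi k w).
  rewrite bigA_distr_bigA/=; apply: eq_bigr => t _; rewrite big_split/=.
  congr (_ * _).
  have [wH|wH] := pselect (H t w).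
    rewrite [RHS]indicE mem_set// big1// => k _.
    by rewrite indicE mem_set//; exact: wH.
  rewrite [RHS]indicE memNset//.
  have [k wk] : exists k, ~ B (t k) (X k w).
    by apply/existsNP => wB; apply: wH => k _; exact: wB.
  by rewrite (bigD1 k)//= indicE memNset// mul0r.
under eq_integral do rewrite expand -sumEFin.
have mFxi a k : measurable_fun setT (fun w => F a (xi k w)).
  exact: (measurableT_comp (mF a)).
rewrite ge0_integral_sum//; last 2 first.
- move=> t; apply/measurable_EFinP/measurable_funM; first exact: measurable_indic.
  by apply: measurable_prod => k _.
- by move=> t w _; rewrite lee_fin mulr_ge0// prodr_ge0.
transitivity (\sum_(t : {ffun 'I_n -> K})
    (\prod_k (fine (P (B (t k))) * m (t k)))%:E)%E.
  apply: eq_bigr => t _.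
  rewrite (@ge0_integral_prod_indep _ _ _ _ _ _ _ xi (H t)
    (fun k => F (t k)) (fun k => m (t k)))//; last exact: indH.
  rewrite big_split/=; congr (_ * _)%:E; rewrite QH.
  rewrite (eq_bigr (fun k => (fine (P (B (t k))))%:E)) ?prodEFin//.
  by move=> k _; rewrite fineK ?fin_num_measure.
rewrite sumEFin -(bigA_distr_bigA (fun (_ : 'I_n) a => fine (P (B a)) * m a)).
congr EFin.
by rewrite prodr_const card_ord.
Qed.

(** * Gaussian moment generating function *)

(** Completing the square turns exp(s x) times the standard density into exp(s^2/2) times the
    density centred at [s], which integrates to 1. *)
Lemma normal_prob_mgf (R : realType) (s : R) :
  (\int[normal_prob 0 1]_x (expR (s * x))%:E = (expR (s ^+ 2 / 2))%:E)%E.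
Proof.
have square (x : R) : - (x - 0) ^+ 2 / (1 ^+ 2 *+ 2) + s * x =
    s ^+ 2 / 2 + - (x - s) ^+ 2 / (1 ^+ 2 *+ 2) by field.
rewrite -(@ge0_integral_transfer _ _ _ _ _ lebesgue_measure (normal_prob 0 1)
  idfun (normal_pdf 0 1))//.
- under eq_integral => x _.
    rewrite (_ : _ * _ = expR (s ^+ 2 / 2) * normal_pdf s 1 x); first over.
    rewrite !normal_pdfE ?oner_neq0// /normal_fun -mulrA -expRD mulrCA -expRD.
    by congr (_ * expR _); exact: square.
  under eq_integral do rewrite EFinM.
  rewrite ge0_integralZl ?integral_normal_pdf ?mule1//.
  + apply/measurable_EFinP; exact: measurable_normal_pdf.
  + by move=> x _; exact: normal_pdf_ge0.
- exact: measurable_id.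
- exact: measurable_normal_pdf.
- by move=> x; exact: normal_pdf_ge0.
- move=> A mA; rewrite /normal_prob [RHS]integral_mkcond.
  apply: eq_integral => x _; rewrite patchE indicE.
  by case: ifP => _; rewrite ?mulr1 ?mulr0.
- by apply: measurableT_comp => //; exact: measurable_funM.
Qed.

(** * From bracketing entropy to finitely many pairs of sets *)

(** The bracketing number is an infimum in the extended reals, so a strict bound yields an actual
    finite cover below it. *)
Lemma bracketing_number_witness d (T : measurableType d) (R : realType)
    (P : probability T R) (F : set (T -> R)) (eps c : R) :
  (lne (bracketing_number P eps F) < c%:E)%E ->
  exists2 N, bracket_cover P eps F N & N%:R < expR c.
Proof.
move=> lnc.
have : (bracketing_number P eps F < (expR c)%:E)%E.
  have := lnc; have := lte_lne.
  case: (bracketing_number P eps F) => [r _|//|_ _]; last by rewrite ltNyr.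
  (* By convention [lne] is -oo at nonpositive reals; there the bound follows from positivity of the
     exponential. *)
  rewrite /= lte_fin; case: ifPn => [r0 _|]; first by rewrite (le_lt_trans r0) ?expR_gt0.
  by rewrite -ltNge => r0; rewrite lte_fin -{2}(@lnK _ r)// ltr_expR.
by move=> /ereal_inf_lt[_ [N FN <-]]; rewrite lte_fin => Nc; exists N.
Qed.

(* Only the sets {l > 0} and {u >= 1} matter for indicators, and on their
   difference the width of the bracket is at least 1. *)
Lemma bracket_cover_sets d (T : measurableType d) (R : realType)
    (P : probability T R) (CC : set (set T)) (eps : R) (N : nat) :
  bracket_cover P eps [set (\1_C : T -> R) | C in CC] N ->
  exists A B : 'I_N -> set T,
    [/\ forall i, measurable (A i) /\ measurable (B i),
        forall i, fine (P (B i `\` A i)) <= eps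
      & forall C, CC C -> exists i, A i `<=` C /\ C `<=` B i].
Proof.
move=> [l [u [lu_L1 lu_eps cover]]].
pose A i := [set x | 0 < l i x]; pose B i := [set x | 1 <= u i x].
have ml i : measurable_fun setT (l i).
  by have [+ _] := lu_L1 i => /sub_Lfun_mfun; rewrite inE.
have mu i : measurable_fun setT (u i).
  by have [_] := lu_L1 i => /sub_Lfun_mfun; rewrite inE.
have mA i : measurable (A i).
  rewrite (_ : A i = l i @^-1` `]0, +oo[); first by rewrite -[_ @^-1` _]setTI; exact: ml.
  by apply/seteqP; split=> x /=; rewrite in_itv/= andbT.
have mB i : measurable (B i).
  rewrite (_ : B i = u i @^-1` `[1, +oo[); first by rewrite -[_ @^-1` _]setTI; exact: mu.
  by apply/seteqP; split=> x /=; rewrite in_itv/= andbT.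
exists A, B; split=> // [i|C CCC]; last first.
  have [|i _ luC] := cover (\1_C); first by exists C.
  exists i; split=> x /=.
  - rewrite /A/= => l0; apply: contrapT => Cx.
    have /andP[+ _] := luC x.
    by rewrite indicE memNset// leNgt l0.
  - by move=> Cx; have /andP[_] := luC x; rewrite indicE mem_set.
have mBA : measurable (B i `\` A i) by exact: measurableD.
rewrite -lee_fin fineK ?fin_num_measure//; apply: le_trans (ltW (lu_eps i)).
rewrite Lnorm1 -[_ `\` _]setIT -integral_indic//.
apply: ge0_le_integral => //=.
- exact/measurable_EFinP/measurable_indic.
- by apply/measurable_EFinP; apply: measurableT_comp => //; exact: measurable_funB.
- move=> x _; rewrite lee_fin; have [[/= u1 l0]|BAx] := pselect ((B i `\` A i) x).
    rewrite indicE mem_set//; move/negP : l0; rewrite /A/= -leNgt => l0.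
    by rewrite /B/= in u1; rewrite ger0_norm; lra.
  by rewrite indicE memNset//= normr_ge0.
Qed.

(** * Exponential weights attached to a bracket *)

Section bracket_weight.
Context d (T : measurableType d) (R : realType).
Implicit Types (A B C D : set T) (x : T) (y : R).

(* With g = 1_C - 1_D and A <= C <= B, the target exp(-(g^2 - 2 y g)/4) is
   determined by A and D off B \ A, where g = 1_A - 1_D; on B \ A it is at most
   exp(y/2) + exp(-y/2).  The last cell overlaps the other three, which is
   harmless since only a lower bound on the weight is needed. *)
Definition weight_cell A B D (a : 'I_4) : set T :=
  nth set0 [:: ~` (A `+` D); A `\` D; D `\` A; B `\` A] a.

Definition weight_factor (a : 'I_4) : R -> R :=
  nth (fun=> 0) [:: fun=> 1;
    fun y => expR (- (1 / 4)) * expR (1 / 2 * y);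
    fun y => expR (- (1 / 4)) * expR (- (1 / 2) * y);
    fun y => expR (1 / 2 * y) + expR (- (1 / 2) * y)] a.

(** Means of the factors under N(0,1). With multiplier t the mean on A Delta D is exp(-t + 2 t^2),
    smallest at t = 1/4, where it equals exp(-1/8); this is the origin of the 1/4. The last entry is
    the price paid on B \ A. *)
Definition weight_mean (a : 'I_4) : R :=
  nth 0 [:: 1; expR (- (1 / 8)); expR (- (1 / 8)); 2 * expR (1 / 8)] a.

Definition bracket_weight A B D x y : R :=
  \sum_a \1_(weight_cell A B D a) x * weight_factor a y.

Lemma measurable_weight_cell A B D a :
  measurable A -> measurable B -> measurable D ->
  measurable (weight_cell A B D a).
Proof.
move=> mA mB mD; case: a => -[|[|[|[|//]]]] ? /=; rewrite /weight_cell/=;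
  try exact: measurableD.
by apply: measurableC; apply: measurableU; exact: measurableD.
Qed.

Lemma measurable_weight_factor a : measurable_fun setT (weight_factor a).
Proof.
have mexp (s : R) : measurable_fun setT (fun y => expR (s * y)).
  by apply: measurableT_comp => //; exact: measurable_funM.
case: a => -[|[|[|[|//]]]] ? /=; rewrite /weight_factor/=.
- exact: measurable_cst.
- exact: measurable_funM.
- exact: measurable_funM.
- exact: measurable_funD.
Qed.

Lemma weight_factor_ge0 a y : 0 <= weight_factor a y.
Proof.
case: a => -[|[|[|[|//]]]] ? /=; rewrite /weight_factor/=.
- exact: ler01.
- by rewrite mulr_ge0 ?expR_ge0.
- by rewrite mulr_ge0 ?expR_ge0.
- by rewrite addr_ge0 ?expR_ge0.
Qed.

Lemma bracket_weight_ge0 A B D x y : 0 <= bracket_weight A B D x y.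
Proof. by apply: sumr_ge0 => a _; rewrite mulr_ge0 ?weight_factor_ge0. Qed.

Lemma integral_weight_factor a :
  (\int[normal_prob 0 1]_y (weight_factor a y)%:E = (weight_mean a)%:E)%E.
Proof.
have mexp (s : R) : measurable_fun setT (fun y => (expR (s * y))%:E).
  apply/measurable_EFinP; apply: measurableT_comp => //; exact: measurable_funM.
have half (s : R) : s ^+ 2 = 1 / 4 ->
    (\int[normal_prob 0 1]_y (expR (s * y))%:E = (expR (1 / 8))%:E)%E.
  by move=> s2; rewrite normal_prob_mgf s2; congr (expR _)%:E; field.
have hp : (1 / 2 : R) ^+ 2 = 1 / 4 by field.
have hm : (- (1 / 2) : R) ^+ 2 = 1 / 4 by field.
have e8 : expR (- (1 / 4)) * expR (1 / 8) = expR (- (1 / 8)) :> R.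
  by rewrite -expRD; congr expR; field.
have scaled (s : R) : s ^+ 2 = 1 / 4 ->
    (\int[normal_prob 0 1]_y (expR (- (1 / 4)) * expR (s * y))%:E =
     (expR (- (1 / 8)))%:E)%E.
  move=> s2; under eq_integral do rewrite EFinM.
  transitivity ((expR (- (1 / 4)))%:E *
      \int[normal_prob 0 1]_y (expR (s * y))%:E)%E.
    by apply: ge0_integralZl => //; exact: mexp.
  by rewrite (half s s2) -EFinM e8.
case: a => -[|[|[|[|//]]]] ? /=; rewrite /weight_factor /weight_mean/=.
- by rewrite integral_cst//= probability_setT mule1.
- exact: scaled.
- exact: scaled.
- under eq_integral do rewrite EFinD.
  transitivity (\int[normal_prob 0 1]_y (expR ((1 / 2 : R) * y))%:E +
      \int[normal_prob 0 1]_y (expR (- (1 / 2 : R) * y))%:E)%E.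
    by apply: ge0_integralD => //; exact: mexp.
  by rewrite (half _ hp) (half _ hm) -EFinD; congr EFin; ring.
Qed.

Lemma bracket_weight_ge A B C D x y : A `<=` C -> C `<=` B ->
  expR (1 / 4 * (y ^+ 2 - (\1_D x + y - \1_C x) ^+ 2)) <=
  bracket_weight A B D x y.
Proof.
move=> AC CB; rewrite /bracket_weight !big_ord_recl big_ord0.
rewrite /weight_cell /weight_factor/= addr0.
have /implyP : (x \in A) ==> (x \in C).
  by apply/implyP => /set_mem/AC/mem_set.
have /implyP : (x \in C) ==> (x \in B).
  by apply/implyP => /set_mem/CB/mem_set.
rewrite !indicE in_setC in_setU !in_setD.
have e1 : expR (- 4^-1) <= 1 :> R by rewrite expR_le1; lra.
have /andP[ep0 ep1] : 0 <= expR (- 4^-1) * expR (2^-1 * y) <= expR (2^-1 * y).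
  by rewrite ler_piMl ?mulr_ge0 ?expR_ge0.
have /andP[em0 em1] : 0 <= expR (- 4^-1) * expR (- 2^-1 * y) <= expR (- 2^-1 * y).
  by rewrite ler_piMl ?mulr_ge0 ?expR_ge0.
(* Covers the points of B \ A where 1_C = 1_D: the target is 1 there, and e^t + e^(-t) >= 2. *)
have cosh1 : 1 <= expR (2^-1 * y) + expR (- 2^-1 * y).
  by have := expR_ge1Dx (2^-1 * y); have := expR_ge1Dx (- 2^-1 * y); lra.
(* The four values of the target, according to membership in C and D, in the form left by the case
   analysis. *)
have g0 : expR (4^-1 * (y ^+ 2 - (y - 0) ^+ 2)) = 1.
  by rewrite -expR0; congr expR; field.
have g0' : expR (4^-1 * (y ^+ 2 - (1 + y - 1) ^+ 2)) = 1.
  by rewrite -expR0; congr expR; field.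
have g1 : expR (4^-1 * (y ^+ 2 - (y - 1) ^+ 2)) = expR (- 4^-1) * expR (2^-1 * y).
  by rewrite -expRD; congr expR; field.
have gN1 : expR (4^-1 * (y ^+ 2 - (1 + y - 0) ^+ 2)) =
    expR (- 4^-1) * expR (- 2^-1 * y).
  by rewrite -expRD; congr expR; field.
case: (x \in A); case: (x \in B); case: (x \in C); case: (x \in D) => //=;
  try (by move=> _ /(_ isT)); try (by move=> /(_ isT)); move=> _ _;
  rewrite ?(mul1r, mul0r, addr0, add0r) ?(g0, g0', g1, gN1); lra.
Qed.

Lemma fine_measureY (P : probability T R) A D : measurable A -> measurable D ->
  fine (P (A `+` D)) = fine (P (A `\` D)) + fine (P (D `\` A)).
Proof.
move=> mA mD; have mAD := measurableD mA mD; have mDA := measurableD mD mA.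
rewrite setY_def measureU//; first by rewrite fineD ?fin_num_measure.
by apply/seteqP; split=> x //= -[[? ?] [? ?]].
Qed.

Lemma symdiff_lossE (P : probability T R) A D : measurable A -> measurable D ->
  symdiff_loss P A D = fine (P (A `+` D)).
Proof.
move=> mA mD; have mY : measurable (A `+` D).
  by apply: measurableU; exact: measurableD.
rewrite /symdiff_loss /Rintegral; congr fine.
rewrite -[A `+` D]setIT -integral_indic//; apply: eq_integral => x _.
rewrite !indicE in_setU !in_setD.
by case: (x \in A); case: (x \in D) => /=; congr EFin; rewrite /=; ring.
Qed.

(** C Delta D is contained in the union of A Delta D and B \ A. The bound no longer depends on C, so
    it survives when C is random. *)
Lemma symdiff_loss_bracket (P : probability T R) A B C D :
  measurable A -> measurable B -> measurable C -> measurable D ->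
  A `<=` C -> C `<=` B ->
  symdiff_loss P C D <= fine (P (A `+` D)) + fine (P (B `\` A)).
Proof.
move=> mA mB mC mD AC CB.
have mAD : measurable (A `+` D) by apply: measurableU; exact: measurableD.
have mBA : measurable (B `\` A) by exact: measurableD.
have mCD : measurable (C `+` D) by apply: measurableU; exact: measurableD.
rewrite symdiff_lossE// -fineD ?fin_num_measure//.
apply: fine_le; rewrite ?fin_numD ?fin_num_measure//.
apply: le_trans (measureU2 _ mAD mBA); apply: le_measure; rewrite ?inE//.
  exact: measurableU.
move=> x [] [].
- move=> Cx Dx; have [Ax|Ax] := pselect (A x); first by left; left.
  by right; split=> //; exact: CB.
- by move=> Dx Cx; left; right; split=> // /AC.
Qed.

(** One weight has mean 1 - (1 - exp(-1/8)) P(A Delta D) + 2 exp(1/8) P(B \ A); apply 1 + t <=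
    exp(t) and take the n-th power. *)
Lemma ge0_integral_bracket_weight d' (S : measurableType d')
    (Q : probability S R) (P : probability T R) (n : nat)
    (X : 'I_n -> {RV Q >-> T}) (xi : 'I_n -> {RV Q >-> R}) A B D :
  iid X P -> iid xi (normal_prob (0 : R) (1 : R)) -> independent_vectors X xi ->
  measurable A -> measurable B -> measurable D ->
  (\int[Q]_w (\prod_k bracket_weight A B D (X k w) (xi k w))%:E <=
    (expR (n%:R * (- ((1 - expR (- (1 / 8))) * fine (P (A `+` D))) +
       2 * expR (1 / 8) * fine (P (B `\` A)))))%:E)%E.
Proof.
move=> Xiid [xiind xilaw] ind mA mB mD.
have xiF a k : (\int[Q]_w (weight_factor a (xi k w))%:E = (weight_mean a)%:E)%E.
  rewrite -integral_weight_factor.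
  (* With density 1 the transfer is the change of variables to the law of [xi k], which is
     prescribed on measurable sets only. *)
  rewrite -(@ge0_integral_transfer _ _ _ _ _ Q (normal_prob 0 1) (xi k) (cst 1))//.
  - by apply: eq_integral => w _; rewrite mul1r.
  - by move=> _ E mE; rewrite setTI; exact: (measurable_funPTI (xi k) mE).
  - move=> E mE; under eq_integral do rewrite mul1r.
    have mxiE : measurable (xi k @^-1` E) by exact: (measurable_funPTI (xi k) mE).
    apply: etrans (xilaw k E mE); rewrite /distribution /pushforward.
    by rewrite -[_ @^-1` _]setIT -integral_indic.
  - exact: measurable_weight_factor.
  - exact: weight_factor_ge0.
rewrite (ge0_integral_regression_prod Xiid xiind ind
  (fun a => measurable_weight_cell a mA mB mD) measurable_weight_factor
  weight_factor_ge0 xiF).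
have mAD : measurable (A `+` D) by apply: measurableU; exact: measurableD.
rewrite lee_fin expRM_natl; apply: lerXn2r; rewrite ?nnegrE ?expR_ge0//.
  apply: sumr_ge0 => a _; rewrite mulr_ge0 ?fine_ge0//.
  case: a => -[|[|[|[|//]]]] ? /=; rewrite /weight_mean/= ?mulr_ge0 ?expR_ge0//.
rewrite !big_ord_recl big_ord0 /weight_cell /weight_mean/= addr0.
apply: le_trans (expR_ge1Dx _).
rewrite probability_setC// fineB ?fin_num_measure//= fine_measureY//.
by rewrite le_eqVlt; apply/orP; left; apply/eqP; ring.
Qed.
End bracket_weight.

(** * Risk bound at a fixed bracketing scale *)

(** The residuals at the true set D are the noise itself, so the pointwise lower bounds multiply to
    exp((RSS(D) - RSS(C))/4), which is at least 1. *)
Lemma bracket_weight_prod_ge1 d (T : measurableType d) (R : realType) (n : nat)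
    (A B C D : set T) (x : 'I_n -> T) (y : 'I_n -> R) :
  let z := [tuple (x i, \1_D (x i) + y i) | i < n] in
  A `<=` C -> C `<=` B ->
  residual_sum_squares z C <= residual_sum_squares z D ->
  1 <= \prod_k bracket_weight A B D (x k) (y k).
Proof.
move=> z AC CB rss.
apply: (@le_trans _ _ (\prod_k
    expR (1 / 4 * (y k ^+ 2 - (\1_D (x k) + y k - \1_C (x k)) ^+ 2)))); last first.
  by apply: ler_prod => k _; rewrite expR_ge0 bracket_weight_ge.
rewrite -expR_sum -mulr_sumr sumrB -[leLHS]expR0 ler_expR mulr_ge0// subr_ge0.
have rssE E : residual_sum_squares z E =
    \sum_k (\1_D (x k) + y k - \1_E (x k)) ^+ 2.
  by apply: eq_bigr => k _; rewrite tnth_mktuple.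
move: rss; rewrite !rssE => /le_trans; apply.
by apply: ler_sum => k _; rewrite addrAC subrr add0r.
Qed.

Lemma measurable_regression_sample d d' (S : measurableType d')
    (T : measurableType d) (R : realType) (Q : probability S R) (n : nat)
    (X : 'I_n -> {RV Q >-> T}) (xi : 'I_n -> {RV Q >-> R}) (D : set T) :
  measurable D -> measurable_fun setT (regression_sample X xi D).
Proof.
move=> mD; apply/measurable_fun_tnthP => i.
rewrite (_ : _ \o _ = fun w => (X i w, \1_D (X i w) + xi i w)); last first.
  by apply/funext => w /=; rewrite tnth_mktuple.
apply: measurable_fun_pair => //; apply: measurable_funD => //.
exact: (measurableT_comp (measurable_indic mD)).
Qed.

(** Here [r] is the bracket width and [c] bounds the log of the number of brackets per observation;
    both stay free until the scale is chosen. *)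
Lemma expected_loss_bound d (T : measurableType d) (R : realType)
    (P : probability T R) (CC : set (set T)) (r c : R) (n : nat) d'
    (S : measurableType d') (Q : probability S R)
    (X : 'I_n -> {RV Q >-> T}) (xi : 'I_n -> {RV Q >-> R})
    (Chat : n.-tuple (T * R) -> set T) (N : nat) (D : set T) :
  (0 < n)%N -> (forall C, CC C -> measurable C) ->
  bracket_cover P r [set (\1_C : T -> R) | C in CC] N ->
  N%:R <= expR (n%:R * c) ->
  iid X P -> iid xi (normal_prob (0 : R) (1 : R)) -> independent_vectors X xi ->
  least_squares_estimator P CC Chat -> CC D -> 0 <= r -> 0 <= c ->
  ('E_Q[(fun w => symdiff_loss P (Chat (regression_sample X xi D w)) D)] <=
   (((1 - expR (- (1 / 8))) * n%:R)^-1 *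
     (1 + n%:R * (c + (1 - expR (- (1 / 8))) * r + 2 * expR (1 / 8) * r)))%:E)%E.
Proof.
move=> n0 mCC cover Nc Xiid xiiid ind [ChatCC Chat_min mChat] CCD r0 c0.
set kappa := 1 - expR (- (1 / 8)).
have mD := mCC _ CCD.
have [A [B [mAB rAB ABcover]]] := bracket_cover_sets cover.
have mA i := (mAB i).1; have mB i := (mAB i).2.
have kappa0 : 0 < kappa by rewrite subr_gt0 expR_lt1; lra.
have n0' : 0 < n%:R :> R by rewrite ltr0n.
pose q i := fine (P (A i `+` D)).
pose W i w := \prod_k bracket_weight (A i) (B i) D (X k w) (xi k w).
(* Chosen so that, after integration, the [kappa * q i] and [r] terms cancel in every exponent and
   exp(-n c) remains for each bracket. *)
pose s := n%:R * (c + kappa * r + 2 * expR (1 / 8) * r).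
pose loss w := symdiff_loss P (Chat (regression_sample X xi D w)) D.
have W0 i w : 0 <= W i w.
  by apply: prodr_ge0 => k _; exact: bracket_weight_ge0.
(* The bracket containing the estimator varies with [w]; summing the nonnegative terms over all
   brackets removes this dependence. *)
have loss_le w : expR (kappa * n%:R * loss w) <=
    \sum_i expR (n%:R * (kappa * r + kappa * q i)) * W i w.
  have [i [AC CB]] := ABcover _ (ChatCC (regression_sample X xi D w)).
  have W1 : 1 <= W i w.
    by apply: bracket_weight_prod_ge1 AC CB _; exact: Chat_min.
  rewrite (bigD1 i)//= -[leLHS]addr0 lerD//; last first.
    by apply: sumr_ge0 => j _; rewrite mulr_ge0 ?expR_ge0.
  rewrite -[leLHS]mulr1 ler_pM ?expR_ge0// ler_expR mulrAC mulrC ler_wpM2l//.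
  rewrite -mulrDr ler_wpM2l ?(ltW kappa0)//.
  apply: le_trans (symdiff_loss_bracket P (mA i) (mB i) (mCC _ (ChatCC _)) mD AC CB) _.
  by rewrite addrC lerD2r.
have mW i : measurable_fun setT (W i).
  apply: measurable_prod => k _; apply: measurable_sum => a.
  apply: measurable_funM.
    by apply: (measurableT_comp (measurable_indic _)) => //; exact: measurable_weight_cell.
  exact: (measurableT_comp (measurable_weight_factor a)).
have intW i : (\int[Q]_w (W i w)%:E <=
    (expR (n%:R * (- (kappa * q i) + 2 * expR (1 / 8) * r)))%:E)%E.
  apply: le_trans (ge0_integral_bracket_weight Xiid xiiid ind (mA i) (mB i) mD) _.
  by rewrite lee_fin ler_expR ler_wpM2l// lerD2l ler_wpM2l.
pose bnd w := (kappa * n%:R)^-1 *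
  (s + \sum_i expR (n%:R * (kappa * r + kappa * q i) - s) * W i w).
have kn0 : 0 < kappa * n%:R by rewrite mulr_gt0.
have s0 : 0 <= s.
  by rewrite mulr_ge0 ?(ltW n0')// !addr_ge0// mulr_ge0// ?(ltW kappa0)// mulr_ge0 ?expR_ge0.
(* The inequality 1 + (t - s) <= exp(t - s) at t = kappa n loss gives a bound linear in the [W i],
   ready to be integrated. *)
have loss_bnd w : loss w <= bnd w.
  rewrite /bnd ler_pdivlMl//.
  have := expR_ge1Dx (kappa * n%:R * loss w - s).
  rewrite expRD; under eq_bigr do rewrite expRD mulrAC.
  rewrite -mulr_suml.
  have := ler_wpM2r (expR_ge0 (- s)) (loss_le w).
  lra.
have loss0 w : 0 <= loss w.
  by apply: Rintegral_ge0 => x _; rewrite sqr_ge0.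
have mloss : measurable_fun setT loss.
  exact: (measurableT_comp (mChat _ CCD) (measurable_regression_sample X xi mD)).
have mWE i (t : R) : measurable_fun setT (fun w => (t * W i w)%:E).
  by apply/measurable_EFinP; exact: measurable_funM.
rewrite unlock; apply: (@le_trans _ _ (\int[Q]_w (bnd w)%:E)%E).
  apply: ge0_le_integral => //.
  - by move=> w _; rewrite lee_fin loss0.
  - exact/measurable_EFinP.
  - apply/measurable_EFinP/measurable_funM => //; apply: measurable_funD => //.
    by apply: measurable_sum => i; exact: measurable_funM.
  - by move=> w _; rewrite lee_fin loss_bnd.
rewrite /bnd; under eq_integral do rewrite EFinM EFinD -sumEFin.
rewrite ge0_integralZl//; last 3 first.
- apply: emeasurable_funD => //; apply: emeasurable_sum => i; exact: mWE.
- move=> w _; rewrite adde_ge0 ?lee_fin// sume_ge0// => i _.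
  by rewrite lee_fin mulr_ge0 ?expR_ge0.
- by rewrite lee_fin invr_ge0 ltW.
rewrite [leRHS]EFinM lee_pmul2l ?lte_fin ?invr_gt0//.
rewrite ge0_integralD//; last 2 first.
- by move=> w _; apply: sume_ge0 => i _; rewrite lee_fin mulr_ge0 ?expR_ge0.
- by apply: emeasurable_sum => i; exact: mWE.
rewrite integral_cst//= probability_setT mule1 ge0_integral_sum//; last first.
  by move=> i w _; rewrite lee_fin mulr_ge0 ?expR_ge0.
rewrite -/s [1 + s]addrC [leRHS]EFinD leeD2l//.
(* At most exp(n c) brackets contribute exp(-n c) each, for a total of at most 1. *)
apply: (@le_trans _ _ (\sum_(i < N) expR (- (n%:R * c)))%:E).
  rewrite -sumEFin; apply: lee_sum => i _; under eq_integral do rewrite EFinM.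
  rewrite ge0_integralZl//; last 2 first.
  - exact/measurable_EFinP.
  - by move=> w _; rewrite lee_fin.
  apply: le_trans (lee_wpmul2l _ (intW i)) _; first by rewrite lee_fin expR_ge0.
  rewrite -EFinM -expRD lee_fin ler_expR le_eqVlt; apply/orP; left; apply/eqP.
  by rewrite /s; ring.
rewrite sumr_const card_ord lee_fin -[leLHS]mulr_natl.
by rewrite expRN ler_pdivrMr ?expR_gt0// mul1r.
Qed.

(** * Choice of the scale and of the constant *)

Theorem theorem3p1 (R : realType) (alpha L : R) :
  0 < alpha -> alpha != 1 -> 0 < L ->
  exists2 K : R, 0 < K &
    forall (d : measure_display) (T : measurableType d) (P : probability T R)
      (CC : set (set T)),
      countable CC ->
      (forall C, CC C -> measurable C) ->
      (forall eps : R, 0 < eps ->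
        (lne (bracketing_number_sets P eps CC)
          <= (L * eps `^ (- alpha))%:E)%E) ->
    forall (n : nat), (0 < n)%N ->
    forall (d' : measure_display) (Omega : measurableType d')
      (Q : probability Omega R)
      (X : 'I_n -> {RV Q >-> T}) (xi : 'I_n -> {RV Q >-> R}),
      iid X P ->
      iid xi (normal_prob (0 : R) (1 : R)) ->
      independent_vectors X xi ->
    forall Chat : n.-tuple (T * R) -> set T,
      least_squares_estimator P CC Chat ->
      (ereal_sup
         [set 'E_Q[(fun w =>
            symdiff_loss P (Chat (regression_sample X xi C0 w)) C0)] | C0 in CC]
       <= (K * n%:R `^ (- (alpha + 1)^-1))%:E)%E.
Proof.
move=> alpha0 _ L0; pose kappa : R := 1 - expR (- (1 / 8)).
have kappa0 : 0 < kappa by rewrite subr_gt0 expR_lt1; lra.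
have M0 : 0 <= 2 * expR (1 / 8) :> R by rewrite mulr_ge0 ?expR_ge0.
(* This is the fixed-scale bound at c = (L + 1) r divided by r, with the leading 1 absorbed through
   1 <= n r. *)
exists (kappa^-1 * (1 + ((L + 1) + kappa + 2 * expR (1 / 8)))).
  by rewrite mulr_gt0 ?invr_gt0//; lra.
move=> d T P CC _ mCC entropy n n0 d' Omega Q X xi Xiid xiiid ind Chat lse.
have n0' : 0 < n%:R :> R by rewrite ltr0n.
have n1 : 1 <= n%:R :> R by rewrite ler1n.
pose r : R := n%:R `^ (- (alpha + 1)^-1).
have r0 : 0 < r by rewrite powR_gt0.
(* Both sides equal n^(alpha/(alpha+1)): the scale balances the entropy against n r. *)
have nr : n%:R * r = r `^ (- alpha).
  rewrite -{1}[n%:R]powRr1 ?ler0n// /r -powRD ?(gt_eqF n0') ?implybT// -powRrM.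
  by congr (_ `^ _); field; rewrite gt_eqF//; lra.
have nr1 : 1 <= n%:R * r.
  rewrite nr /r -powRrM mulrNN -[leLHS](powRr0 n%:R) ler_powR//.
  by rewrite mulr_ge0 ?invr_ge0; lra.
(* The entropy is at most L n r; taking L + 1 instead of L gives the strict inequality that
   extracting a cover requires. *)
have [|N cover Nlt] := @bracketing_number_witness _ _ _ P
    [set (\1_C : T -> R) | C in CC] r (n%:R * ((L + 1) * r)).
  apply: le_lt_trans (entropy r r0) _; rewrite lte_fin -nr; lra.
apply: ge_ereal_sup => _ [D CCD <-].
have c0 : 0 <= (L + 1) * r by rewrite mulr_ge0//; lra.
apply: le_trans (expected_loss_bound n0 mCC cover (ltW Nlt) Xiid xiiid ind lse
  CCD (ltW r0) c0) _.
rewrite -/kappa lee_fin invfM -!mulrA ler_wpM2l ?invr_ge0 ?(ltW kappa0)//.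
rewrite ler_pdivrMl// -/r; nra.
Qed.
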